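(* Let $\mathbf{k}$ be a field, $\lambda\in\mathbf{k}$, and let $D=(D,\prec,\succ)$ be a dendriform dialgebra over $\mathbf{k}$. Let $T(D)=\bigoplus_{n\ge1}D^{\otimes n}$ be the (nonunitary) tensor algebra over the $\mathbf{k}$-module $D$, let $\mathrm{Sha}_\lambda(T(D))$ be the free nonunitary Rota-Baxter algebra of weight $\lambda$ over the algebra $T(D)$, and let $i_D:D\to T(D)\xrightarrow{j_{T(D)}}\mathrm{Sha}_\lambda(T(D))$ be the natural injection. Let $J_R$ be the Rota-Baxter ideal of $\mathrm{Sha}_\lambda(T(D))$ generated by $$\{\,x\prec y-x\lfloor y\rfloor-\lambda\,x\otimes y,\ \ x\succ y-\lfloor x\rfloor y\ \mid\ x,y\in D\,\},$$ and let $\pi:\mathrm{Sha}_\lambda(T(D))\to\mathrm{Sha}_\lambda(T(D))/J_R$ be the quotient map. Then the quotient Rota-Baxter algebra $\mathrm{Sha}_\lambda(T(D))/J_R$, together with $\rho:=\pi\circ i_D$, is the universal enveloping Rota-Baxter algebra of $D$ of weight $\lambda$.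
   Context: A nonunitary $\mathbf{k}$-algebra is an associative $\mathbf{k}$-algebra not required to have a unit. A nonunitary Rota-Baxter algebra of weight $\lambda$ is a pair $(A,R)$ with $A$ a nonunitary $\mathbf{k}$-algebra and $R:A\to A$ a $\mathbf{k}$-linear map such that $R(x)R(y)=R(R(x)y+xR(y)+\lambda xy)$ for all $x,y\in A$. A homomorphism $(A,R)\to(A',R')$ is a nonunitary algebra homomorphism $g$ with $g\circ R=R'\circ g$. A Rota-Baxter ideal of $(A,R)$ is a two-sided ideal $I$ with $R(I)\subseteq I$; the Rota-Baxter ideal generated by a subset is the intersection of all Rota-Baxter ideals containing it. A dendriform dialgebra is a $\mathbf{k}$-module $D$ with bilinear operations $\prec,\succ$ such that for all $x,y,z\in D$: $(x\prec y)\prec z=x\prec(y\prec z+y\succ z)$, $(x\succ y)\prec z=x\succ(y\prec z)$, $(x\prec y+x\succ y)\succ z=x\succ(y\succ z)$. Morphisms are linear maps preserving both operations. Every nonunitary Rota-Baxter algebra $(A,R)$ of weight $\lambda$ is regarded as a dendriform dialgebra with $x\prec'_R y=xR(y)+\lambda xy$, $x\succ'_R y=R(x)y$. A universal enveloping Rota-Baxter algebra of weight $\lambda$ of a dendriform dialgebra $D$ is a nonunitary Rota-Baxter algebra $U$ of weight $\lambda$ with a morphism of dendriform dialgebras $\rho:D\to U$ such that for every nonunitary Rota-Baxter algebra $A$ of weight $\lambda$ and every morphism of dendriform dialgebras $f:D\to A$ there is a unique homomorphism of nonunitary Rota-Baxter algebras $\check f:U\to A$ with $\check f\circ\rho=f$.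 The free nonunitary Rota-Baxter algebra of weight $\lambda$ over a nonunitary algebra $B$ is a nonunitary Rota-Baxter algebra $(\mathrm{Sha}_\lambda(B),R_B)$ of weight $\lambda$ with a nonunitary algebra homomorphism $j_B:B\to\mathrm{Sha}_\lambda(B)$ such that for every nonunitary Rota-Baxter algebra $A$ of weight $\lambda$ and nonunitary algebra homomorphism $f:B\to A$ there is a unique Rota-Baxter homomorphism $\bar f:\mathrm{Sha}_\lambda(B)\to A$ with $\bar f\circ j_B=f$. (It exists, and $j_B$ is injective.) In the claim $B=T(D)$; elements of $D$ and $T(D)$ are identified with their images in $\mathrm{Sha}_\lambda(T(D))$, we write $\lfloor u\rfloor=R_{T(D)}(u)$, and for $x,y\in D$ the expressions $x\lfloor y\rfloor$ and $\lfloor x\rfloor y$ denote the products of $x$ with $\lfloor y\rfloor$, respectively of $\lfloor x\rfloor$ with $y$, in $\mathrm{Sha}_\lambda(T(D))$, while $x\otimes y\in D^{\otimes2}\subseteq T(D)$, and $x\prec y,\ x\succ y\in D$. *)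

(* Defs.v *)
From HB Require Import structures.
From mathcomp Require Import all_boot all_order all_algebra.
From mathcomp Require Import boolp classical_sets.
From mathcomp Require Import freeg.

Set Implicit Arguments.
Unset Strict Implicit.
Unset Printing Implicit Defensive.

Import GRing.Theory.

Local Open Scope ring_scope.
Local Open Scope quotient_scope.
Local Open Scope classical_set_scope.

Reserved Notation "x ** y" (at level 40, left associativity).
Reserved Notation "x -< y" (at level 40, left associativity).
Reserved Notation "x >- y" (at level 40, left associativity).

HB.mixin Record Lmodule_isNuAlgebra (k : comNzRingType) A
    of GRing.Lmodule k A := {
  numul : A -> A -> A;
  numulA : associative numul;
  numulPl : forall (a : k) x y z,
    numul (a *: x + y) z = a *: numul x z + numul y z;
  numulPr : forall (a : k) x y z,
    numul x (a *: y + z) = a *: numul x y + numul x z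
}.

#[short(type="nuAlgType")]
HB.structure Definition NuAlgebra (k : comNzRingType) :=
  {A of Lmodule_isNuAlgebra k A & GRing.Lmodule k A}.

Notation "x ** y" := (numul x y) : ring_scope.

Definition nualg_hom (k : comNzRingType) (A B : nuAlgType k) (f : A -> B) :=
  linear f /\ {morph f : x y / x ** y}.

HB.mixin Record NuAlgebra_isRotaBaxter (k : comNzRingType) (lam : k) A
    of NuAlgebra k A := {
  rbop : A -> A;
  rbop_linear : linear rbop;
  rbopM : forall x y : A,
    rbop x ** rbop y = rbop (rbop x ** y + x ** rbop y + lam *: (x ** y))
}.

#[short(type="rbAlgType")]
HB.structure Definition RotaBaxter (k : comNzRingType) (lam : k) :=
  {A of NuAlgebra_isRotaBaxter k lam A & NuAlgebra k A}.

Arguments rbop {k lam s} _.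

Definition rb_hom (k : comNzRingType) (lam : k) (A B : rbAlgType lam)
    (f : A -> B) :=
  nualg_hom f /\ {morph f : x / rbop x}.

HB.mixin Record Lmodule_isDendriform (k : comNzRingType) D
    of GRing.Lmodule k D := {
  dprec : D -> D -> D;
  dsucc : D -> D -> D;
  dprecPl : forall (a : k) x y z,
    dprec (a *: x + y) z = a *: dprec x z + dprec y z;
  dprecPr : forall (a : k) x y z,
    dprec x (a *: y + z) = a *: dprec x y + dprec x z;
  dsuccPl : forall (a : k) x y z,
    dsucc (a *: x + y) z = a *: dsucc x z + dsucc y z;
  dsuccPr : forall (a : k) x y z,
    dsucc x (a *: y + z) = a *: dsucc x y + dsucc x z;
  dend_prec_prec : forall x y z,
    dprec (dprec x y) z = dprec x (dprec y z + dsucc y z);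
  dend_succ_prec : forall x y z,
    dprec (dsucc x y) z = dsucc x (dprec y z);
  dend_succ_succ : forall x y z,
    dsucc (dprec x y + dsucc x y) z = dsucc x (dsucc y z)
}.

#[short(type="dendType")]
HB.structure Definition Dendriform (k : comNzRingType) :=
  {D of Lmodule_isDendriform k D & GRing.Lmodule k D}.

Notation "x -< y" := (dprec x y) : ring_scope.
Notation "x >- y" := (dsucc x y) : ring_scope.

Definition dend_hom (k : comNzRingType) (D E : dendType k) (f : D -> E) :=
  [/\ linear f, {morph f : x y / x -< y} & {morph f : x y / x >- y}].

Lemma linearPP (k : comNzRingType) (U V : lmodType k) (f : U -> V) :
  linear f -> [/\ forall x y, f (x + y) = f x + f y,
                  forall a x, f (a *: x) = a *: f x & f 0 = 0].
Proof.
move=> lf; have f0 : f 0 = 0.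
  by have := lf (-1) 0 0; rewrite scaleN1r oppr0 add0r => ->; rewrite scaleN1r addNr.
split=> // [x y|a x]; first by have := lf 1 x y; rewrite !scale1r.
by have := lf a x 0; rewrite f0 !addr0.
Qed.

Section NuAlgebraTheory.
Variables (k : comNzRingType) (A : nuAlgType k).
Implicit Types (a : k) (x y z : A).

Lemma numulDl x y z : (x + y) ** z = x ** z + y ** z.
Proof. by have := numulPl 1 x y z; rewrite !scale1r. Qed.
Lemma numulDr x y z : x ** (y + z) = x ** y + x ** z.
Proof. by have := numulPr 1 x y z; rewrite !scale1r. Qed.
Lemma numul0l z : 0 ** z = 0.
Proof. by apply: (addrI (0 ** z)); rewrite -numulDl !addr0. Qed.
Lemma numul0r x : x ** 0 = 0.
Proof. by apply: (addrI (x ** 0)); rewrite -numulDr !addr0. Qed.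
Lemma numulZl a x z : (a *: x) ** z = a *: (x ** z).
Proof. by have := numulPl a x 0 z; rewrite numul0l !addr0. Qed.
Lemma numulZr a x y : x ** (a *: y) = a *: (x ** y).
Proof. by have := numulPr a x y 0; rewrite numul0r !addr0. Qed.
Lemma numulNl x z : (- x) ** z = - (x ** z).
Proof. by rewrite -scaleN1r numulZl scaleN1r. Qed.
Lemma numulNr x z : x ** (- z) = - (x ** z).
Proof. by rewrite -scaleN1r numulZr scaleN1r. Qed.

End NuAlgebraTheory.

(* The alias [rbDend A] carries the dendriform structure of a Rota-Baxter
   algebra [A], so that it cannot interfere with another dendriform structure
   that the type [A] might have. *)
Definition rbDend (k : comNzRingType) (lam : k) (A : rbAlgType lam) : Type := A.

Section RotaBaxterDendriform.
Variables (k : comNzRingType) (lam : k) (A : rbAlgType lam).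

HB.instance Definition _ := GRing.Lmodule.on (rbDend A).

Definition rb_prec (x y : A) : A := x ** rbop y + lam *: (x ** y).
Definition rb_succ (x y : A) : A := rbop x ** y.

Let rbD (x y : A) : rbop (x + y) = rbop x + rbop y.
Proof. by have [-> _ _] := linearPP (@rbop_linear k lam A). Qed.
Let rbZ a (x : A) : rbop (a *: x) = a *: rbop x.
Proof. by have [_ -> _] := linearPP (@rbop_linear k lam A). Qed.

Lemma rb_precPl a x y z :
  rb_prec (a *: x + y) z = a *: rb_prec x z + rb_prec y z.
Proof.
rewrite /rb_prec !numulPl !scalerDr addrACA; congr (_ + _ + _).
by rewrite !scalerA mulrC.
Qed.

Lemma rb_precPr a x y z :
  rb_prec x (a *: y + z) = a *: rb_prec x y + rb_prec x z.
Proof.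
rewrite /rb_prec rbop_linear !numulPr !scalerDr addrACA; congr (_ + _ + _).
by rewrite !scalerA mulrC.
Qed.

Lemma rb_succPl a x y z :
  rb_succ (a *: x + y) z = a *: rb_succ x z + rb_succ y z.
Proof. by rewrite /rb_succ rbop_linear numulPl. Qed.

Lemma rb_succPr a x y z :
  rb_succ x (a *: y + z) = a *: rb_succ x y + rb_succ x z.
Proof. by rewrite /rb_succ numulPr. Qed.

Lemma rb_prec_prec x y z :
  rb_prec (rb_prec x y) z = rb_prec x (rb_prec y z + rb_succ y z).
Proof.
rewrite /rb_prec /rb_succ.
have -> : y ** rbop z + lam *: (y ** z) + rbop y ** z =
          rbop y ** z + y ** rbop z + lam *: (y ** z).
  by rewrite addrC addrA.
rewrite -rbopM !numulDl !numulDr !scalerDr !numulZl !numulZr !numulA -!addrA.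
by congr (_ + _); rewrite addrCA.
Qed.

Lemma rb_succ_prec x y z :
  rb_prec (rb_succ x y) z = rb_succ x (rb_prec y z).
Proof. by rewrite /rb_prec /rb_succ numulDr numulZr !numulA. Qed.

Lemma rb_succ_succ x y z :
  rb_succ (rb_prec x y + rb_succ x y) z = rb_succ x (rb_succ y z).
Proof.
rewrite /rb_prec /rb_succ numulA rbopM; congr (rbop _ ** _).
by rewrite addrC addrA.
Qed.

HB.instance Definition _ := Lmodule_isDendriform.Build k (rbDend A)
  rb_precPl rb_precPr rb_succPl rb_succPr
  rb_prec_prec rb_succ_prec rb_succ_succ.

End RotaBaxterDendriform.

Record submodule (k : comNzRingType) (V : lmodType k) := Submodule {
  submod_set :> set V;
  submod0 : submod_set 0;
  submodP : forall (a : k) u v,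
    submod_set u -> submod_set v -> submod_set (a *: u + v)
}.

Section Span.
Variables (k : comNzRingType) (V : lmodType k) (X : set V).

Definition span_set : set V :=
  \bigcap_(W in [set W : submodule V | X `<=` W]) W.

Lemma span_set0 : span_set 0.
Proof. by move=> W _; exact: submod0. Qed.

Lemma span_setP (a : k) u v : span_set u -> span_set v -> span_set (a *: u + v).
Proof. by move=> hu hv W XW; apply: submodP; [exact: hu | exact: hv]. Qed.

Definition span : submodule V := Submodule span_set0 span_setP.

End Span.

Section QuotientModule.
Variables (k : comNzRingType) (V : lmodType k) (W : submodule V).

Definition submod_pred : {pred V} := fun x => `[< submod_set W x >].

Lemma submod_pred_closed : submod_closed submod_pred.
Proof.
split=> [|a u v]; rewrite !unfold_in; first by apply/asboolP/submod0.
by move=> /asboolP hu /asboolP hv; apply/asboolP/submodP.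
Qed.

HB.instance Definition _ :=
  GRing.isSubmodClosed.Build k V submod_pred submod_pred_closed.

Definition quotmod : Type := {ideal_quot submod_pred}.

HB.instance Definition _ := GRing.Zmodule.on quotmod.
HB.instance Definition _ := ZmodQuotient.on quotmod.

Definition quotpi (x : V) : quotmod := \pi_quotmod x.

Lemma quotpi_eq x y : quotpi x = quotpi y <-> submod_set W (x - y).
Proof.
rewrite /quotpi; split => [/eqP|Wxy].
  by rewrite -[_ == _]Quotient.idealrBE unfold_in => /asboolP.
by apply/eqP; rewrite -[_ == _]Quotient.idealrBE unfold_in; apply/asboolP.
Qed.

Lemma quotpi_repr (q : quotmod) : quotpi (repr q) = q.
Proof. exact: reprK. Qed.

Lemma quotpiD x y : quotpi (x + y) = quotpi x + quotpi y.
Proof. by rewrite /quotpi piE. Qed.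

Definition quot_scale (a : k) (q : quotmod) : quotmod := quotpi (a *: repr q).

Lemma quotpi_scale a x : quotpi (a *: x) = quot_scale a (quotpi x).
Proof.
apply/quotpi_eq; rewrite -scalerBr -[_ *: _]addr0; apply: submodP (submod0 W).
by apply/quotpi_eq; rewrite quotpi_repr.
Qed.

Lemma quot_scaleA a b q : quot_scale a (quot_scale b q) = quot_scale (a * b) q.
Proof. by rewrite -[q]quotpi_repr -!quotpi_scale scalerA. Qed.
Lemma quot_scale1 : left_id 1 quot_scale.
Proof. by move=> q; rewrite -[q]quotpi_repr -!quotpi_scale scale1r. Qed.
Lemma quot_scaleDr : right_distributive quot_scale +%R.
Proof.
move=> a p q; rewrite -[p]quotpi_repr -[q]quotpi_repr.
by rewrite -quotpiD -!quotpi_scale scalerDr quotpiD.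
Qed.
Lemma quot_scaleDl q : {morph quot_scale^~ q : a b / a + b}.
Proof.
by move=> a b; rewrite -[q]quotpi_repr -!quotpi_scale scalerDl quotpiD.
Qed.

HB.instance Definition _ := GRing.Zmodule_isLmodule.Build k quotmod
  quot_scaleA quot_scale1 quot_scaleDr quot_scaleDl.

Lemma quotpi_linear : linear quotpi.
Proof. by move=> a x y; rewrite quotpiD quotpi_scale. Qed.

End QuotientModule.

Record rbideal (k : comNzRingType) (lam : k) (A : rbAlgType lam) := RBIdeal {
  rbideal_submod :> submodule A;
  rbidealMl : forall a x : A, submod_set rbideal_submod x -> submod_set rbideal_submod (a ** x);
  rbidealMr : forall x a : A, submod_set rbideal_submod x -> submod_set rbideal_submod (x ** a);
  rbidealR : forall x : A, submod_set rbideal_submod x -> submod_set rbideal_submod (rbop x)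
}.

Section RBGenerated.
Variables (k : comNzRingType) (lam : k) (A : rbAlgType lam) (X : set A).

Definition rbgen_set : set A :=
  \bigcap_(I in [set I : rbideal A | X `<=` I]) I.

Lemma rbgen_set0 : rbgen_set 0.
Proof. by move=> I _; exact: submod0. Qed.
Lemma rbgen_setP (a : k) u v :
  rbgen_set u -> rbgen_set v -> rbgen_set (a *: u + v).
Proof. by move=> hu hv I XI; apply: submodP; [exact: hu | exact: hv]. Qed.
Lemma rbgen_setMl a x : rbgen_set x -> rbgen_set (a ** x).
Proof. by move=> hx I XI; apply/rbidealMl/hx. Qed.
Lemma rbgen_setMr x a : rbgen_set x -> rbgen_set (x ** a).
Proof. by move=> hx I XI; apply/rbidealMr/hx. Qed.
Lemma rbgen_setR x : rbgen_set x -> rbgen_set (rbop x).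
Proof. by move=> hx I XI; apply/rbidealR/hx. Qed.

Definition rbgen : rbideal A :=
  @RBIdeal k lam A (Submodule rbgen_set0 rbgen_setP)
    rbgen_setMl rbgen_setMr rbgen_setR.

End RBGenerated.

Definition rbquot (k : comNzRingType) (lam : k) (A : rbAlgType lam)
  (I : rbideal A) : Type := quotmod I.

Section RBQuotient.
Variables (k : comNzRingType) (lam : k) (A : rbAlgType lam) (I : rbideal A).

HB.instance Definition _ := GRing.Lmodule.on (rbquot I).

Definition rbpi : A -> rbquot I := @quotpi k A I.

Definition rbquot_mul (p q : rbquot I) : rbquot I := rbpi (repr p ** repr q).
Definition rbquot_op (p : rbquot I) : rbquot I := rbpi (rbop (repr p)).

Lemma rbpi_repr (p : rbquot I) : rbpi (repr p) = p.
Proof. exact: quotpi_repr. Qed.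

Lemma rbpi_eq (x y : A) : rbpi x = rbpi y <-> submod_set I (x - y).
Proof. exact: quotpi_eq. Qed.

Lemma rbpi_linear : linear rbpi.
Proof. exact: quotpi_linear. Qed.

Lemma rbpiM x y : rbpi (x ** y) = rbquot_mul (rbpi x) (rbpi y).
Proof.
apply/rbpi_eq; set x' := repr _; set y' := repr _.
have -> : x ** y - x' ** y' = 1 *: ((x - x') ** y) + x' ** (y - y').
  by rewrite scale1r numulDl numulDr numulNl numulNr addrA addrNK.
apply: submodP; [apply: rbidealMr | apply: rbidealMl];
  by apply/rbpi_eq; rewrite rbpi_repr.
Qed.

Lemma rbpiR x : rbpi (rbop x) = rbquot_op (rbpi x).
Proof.
apply/rbpi_eq; set x' := repr _.
have -> : rbop x - rbop x' = rbop (x - x').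
  have := @rbop_linear k lam A (-1) x' x.
  by rewrite !scaleN1r ![- _ + _]addrC => ->.
by apply/rbidealR/rbpi_eq; rewrite rbpi_repr.
Qed.

Lemma rbquot_mulA : associative rbquot_mul.
Proof.
move=> p q r; rewrite -[p]rbpi_repr -[q]rbpi_repr -[r]rbpi_repr.
by rewrite -!rbpiM numulA.
Qed.

Lemma rbquot_mulPl (a : k) p q r :
  rbquot_mul (a *: p + q) r = a *: rbquot_mul p r + rbquot_mul q r.
Proof.
rewrite -[p]rbpi_repr -[q]rbpi_repr -[r]rbpi_repr.
by rewrite -rbpi_linear -!rbpiM numulPl rbpi_linear.
Qed.

Lemma rbquot_mulPr (a : k) p q r :
  rbquot_mul p (a *: q + r) = a *: rbquot_mul p q + rbquot_mul p r.
Proof.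
rewrite -[p]rbpi_repr -[q]rbpi_repr -[r]rbpi_repr.
by rewrite -rbpi_linear -!rbpiM numulPr rbpi_linear.
Qed.

HB.instance Definition _ := Lmodule_isNuAlgebra.Build k (rbquot I)
  rbquot_mulA rbquot_mulPl rbquot_mulPr.

Lemma rbquot_op_linear : linear rbquot_op.
Proof.
move=> a p q; rewrite -[p]rbpi_repr -[q]rbpi_repr.
by rewrite -rbpi_linear -!rbpiR rbop_linear rbpi_linear.
Qed.

Lemma rbquot_opM (p q : rbquot I) :
  rbquot_op p ** rbquot_op q =
  rbquot_op (rbquot_op p ** q + p ** rbquot_op q + lam *: (p ** q)).
Proof.
have piM x y : rbpi x ** rbpi y = rbpi (x ** y) by rewrite rbpiM.
have [piD piZ _] := linearPP rbpi_linear.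
rewrite -[p]rbpi_repr -[q]rbpi_repr -!rbpiR !piM -piZ -!piD -rbpiR.
by rewrite rbopM.
Qed.

HB.instance Definition _ := NuAlgebra_isRotaBaxter.Build k lam (rbquot I)
  rbquot_op_linear rbquot_opM.

Lemma rbpi_hom : rb_hom rbpi.
Proof.
split; last exact: rbpiR.
by split; [exact: rbpi_linear | exact: rbpiM].
Qed.

End RBQuotient.

(* Replaces the entry of index [i] of [t] by [x]. *)
Definition tupd (T : Type) n (t : n.-tuple T) (i : 'I_n) (x : T) : n.-tuple T :=
  [tuple (if j == i then x else tnth t j) | j < n].

Definition multilinear (k : comNzRingType) (D V : lmodType k) n
    (f : n.-tuple D -> V) :=
  forall t i, linear (fun x => f (tupd t i x)).

Section TensorPower.
Variables (k : comNzRingType) (D : lmodType k) (n : nat).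
Local Notation F := {freeg (n.-tuple D) / k}.

(* [tpow] is the free module on D^n modulo the multilinearity relations. *)
Definition tens_rel : set F :=
  [set r | exists t i a x y,
     r = << tupd t i (a *: x + y) >>
         - (a *: << tupd t i x >> + << tupd t i y >>)].

Definition tpow : lmodType k := quotmod (span tens_rel).

Definition tpure (t : n.-tuple D) : tpow := quotpi (span tens_rel) << t >>.

Lemma tpure_multilinear : multilinear tpure.
Proof.
move=> t i a x y; rewrite /tpure -quotpi_linear; apply/quotpi_eq => W; apply.
by exists t, i, a, x, y.
Qed.

Lemma fgliftD (V : lmodType k) (f : n.-tuple D -> V) :
  {morph fglift f : x y / x + y}.
Proof.
have fB := lift_is_additive f.
have f0 : fglift f 0 = 0 by have := fB 0 0; rewrite !subrr.
move=> x y; have := fB x (- y); rewrite opprK => ->.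
by have := fB 0 y; rewrite f0 !sub0r => ->; rewrite opprK.
Qed.

Lemma fglift0 (V : lmodType k) (f : n.-tuple D -> V) : fglift f 0 = 0.
Proof. by have := lift_is_additive f 0 0; rewrite !subrr. Qed.

Lemma fgliftE (V : lmodType k) (f : n.-tuple D -> V) (d : F) :
  fglift f d = \sum_(t <- dom d) coeff t d *: f t.
Proof.
rewrite -{1}[d]freeg_sumE (big_morph _ (fgliftD f) (fglift0 f)).
by apply: eq_bigr => t _; rewrite liftU.
Qed.

Lemma fglift_linear (V : lmodType k) (f : n.-tuple D -> V) : linear (fglift f).
Proof.
move=> a x y; rewrite fgliftD; congr (_ + _).
rewrite [in RHS](fgliftE f x) [RHS]scaler_sumr.
rewrite [a *: x]/(fgscale a x) /fgscale (big_morph _ (fgliftD f) (fglift0 f)).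
by apply: eq_bigr => t _; rewrite liftU scalerA.
Qed.

(* The linear map induced by [f]; meaningful only when [f] is multilinear. *)
Definition tlift (V : lmodType k) (f : n.-tuple D -> V) (u : tpow) : V :=
  fglift f (repr u).

Section Lift.
Variables (V : lmodType k) (f : n.-tuple D -> V).
Hypothesis f_ml : multilinear f.

Lemma tlift_pi (d : F) : tlift f (quotpi (span tens_rel) d) = fglift f d.
Proof.
have [fD fZ f0] := linearPP (fglift_linear f).
have Kf (u v : F) a : fglift f u = 0 -> fglift f v = 0 ->
    fglift f (a *: u + v) = 0.
  by move=> fu fv; rewrite fD fZ fu fv scaler0 addr0.
pose W : submodule F := @Submodule k F [set d | fglift f d = 0] f0
  (fun a u v => Kf u v a).
rewrite /tlift; set d' := repr _.
suff : fglift f (d' - d) = 0.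
  by rewrite fD -scaleN1r fZ scaleN1r => /eqP; rewrite subr_eq0 => /eqP.
have : submod_set (span tens_rel) (d' - d) by apply/quotpi_eq; rewrite quotpi_repr.
move/(_ W); apply => _ [t [i [a [x [y ->]]]]] /=.
rewrite fD -scaleN1r fZ fD fZ !liftU !scale1r f_ml scaleN1r; exact: subrr.
Qed.

Lemma tlift_pure t : tlift f (tpure t) = f t.
Proof. by rewrite /tpure tlift_pi liftU scale1r. Qed.

Lemma tlift_linear : linear (tlift f).
Proof.
move=> a u v; rewrite -[u]quotpi_repr -[v]quotpi_repr.
by rewrite -quotpi_linear !tlift_pi fglift_linear.
Qed.

End Lift.

Lemma tlift_linearf (V : lmodType k) u (a : k) (f g h : n.-tuple D -> V) :
  (forall t, h t = a *: f t + g t) -> tlift h u = a *: tlift f u + tlift g u.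
Proof.
move=> hE; rewrite /tlift !fgliftE scaler_sumr -big_split /=.
by apply: eq_bigr => t _; rewrite hE scalerDr !scalerA mulrC.
Qed.

Lemma tpow_ind (P : tpow -> Prop) :
  P 0 -> (forall a u v, P u -> P v -> P (a *: u + v)) ->
  (forall t, P (tpure t)) -> forall u, P u.
Proof.
move=> P0 PP Pt u; rewrite -[u]quotpi_repr -[repr u]freeg_sumE.
elim: (dom _) => [|t s IH].
  have [_ _ ] := linearPP (quotpi_linear (span tens_rel)).
  by rewrite big_nil => ->.
rewrite big_cons.
have -> : << coeff t (repr u) *g t >> = coeff t (repr u) *: << t >> :> F.
  apply/eqP/freeg_eqP => z.
  by rewrite coeffZ !coeffU mul1r.
by rewrite quotpi_linear; apply: PP => //; exact: Pt.
Qed.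

End TensorPower.

Section Concatenation.
Variables (k : comNzRingType) (D : lmodType k) (m n : nat).

Lemma cat_tupdl (s : m.-tuple D) (t : n.-tuple D) i x :
  [tuple of tupd s i x ++ t] = tupd [tuple of s ++ t] (lshift n i) x.
Proof.
apply: eq_from_tnth => j; rewrite -[j]splitK; case: (split j) => l /=.
  by rewrite tnth_lshift !tnth_mktuple eq_lshift tnth_lshift.
by rewrite tnth_rshift tnth_mktuple eq_rlshift tnth_rshift.
Qed.

Lemma cat_tupdr (s : m.-tuple D) (t : n.-tuple D) i x :
  [tuple of s ++ tupd t i x] = tupd [tuple of s ++ t] (rshift m i) x.
Proof.
apply: eq_from_tnth => j; rewrite -[j]splitK; case: (split j) => l /=.
  by rewrite tnth_lshift tnth_mktuple eq_lrshift tnth_lshift.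
by rewrite tnth_rshift !tnth_mktuple eq_rshift tnth_rshift.
Qed.

Definition tconcat (u : tpow D m) (v : tpow D n) : tpow D (m + n) :=
  tlift (fun s : m.-tuple D =>
    tlift (fun t : n.-tuple D => tpure [tuple of s ++ t]) v) u.

Let inner_ml (s : m.-tuple D) : multilinear (fun t : n.-tuple D => tpure [tuple of s ++ t]).
Proof.
by move=> t i a x y; rewrite !cat_tupdr (@tpure_multilinear k D (m + n)).
Qed.

Let outer_ml v : multilinear
  (fun s : m.-tuple D => tlift (fun t : n.-tuple D => tpure [tuple of s ++ t]) v).
Proof.
move=> s i a x y; apply: tlift_linearf => t.
by rewrite !cat_tupdl (@tpure_multilinear k D (m + n)).
Qed.

Lemma tconcat_pure (s : m.-tuple D) (t : n.-tuple D) :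
  tconcat (tpure s) (tpure t) = tpure [tuple of s ++ t].
Proof.
rewrite /tconcat (tlift_pure (outer_ml _)).
exact: (tlift_pure (inner_ml _)).
Qed.

Lemma tconcatPl a u v w :
  tconcat (a *: u + v) w = a *: tconcat u w + tconcat v w.
Proof. exact: (tlift_linear (outer_ml w)). Qed.

Lemma tconcatPr a u v w :
  tconcat u (a *: v + w) = a *: tconcat u v + tconcat u w.
Proof.
by apply: tlift_linearf => s; exact: (tlift_linear (inner_ml s)).
Qed.

End Concatenation.

Section DirectSum.
Variables (k : comNzRingType) (V : nat -> lmodType k).

Definition fin_supp (f : forall i, V i) : bool :=
  `[< exists N, forall i, (N <= i)%N -> f i = 0 >].

Record dsum := DSum { dsum_fun :> forall i, V i; _ : fin_supp dsum_fun }.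

HB.instance Definition _ := [isSub for dsum_fun].
HB.instance Definition _ := [Choice of dsum by <:].

Lemma dsumP (u v : dsum) : (forall i, u i = v i) -> u = v.
Proof. by move=> uv; apply/val_inj/functional_extensionality_dep. Qed.

Lemma dsum_supp (u : dsum) : exists N, forall i, (N <= i)%N -> u i = 0.
Proof. by case: u => f /= /asboolP. Qed.

Lemma fin_supp0 : fin_supp (fun i => 0 : V i).
Proof. by apply/asboolP; exists 0%N. Qed.
Lemma fin_suppN (u : dsum) : fin_supp (fun i => - u i).
Proof.
have [N uN] := dsum_supp u; apply/asboolP; exists N => i /uN ->.
exact: oppr0.
Qed.
Lemma fin_suppD (u v : dsum) : fin_supp (fun i => u i + v i).
Proof.
have [[N uN] [M vM]] := (dsum_supp u, dsum_supp v).
apply/asboolP; exists (maxn N M) => i; rewrite geq_max => /andP[/uN -> /vM ->].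
exact: addr0.
Qed.
Lemma fin_suppZ a (u : dsum) : fin_supp (fun i => a *: u i).
Proof.
have [N uN] := dsum_supp u; apply/asboolP; exists N => i /uN ->.
exact: scaler0.
Qed.

Definition dsum0 := DSum fin_supp0.
Definition dsum_opp u := DSum (fin_suppN u).
Definition dsum_add u v := DSum (fin_suppD u v).
Definition dsum_scale a u := DSum (fin_suppZ a u).

Lemma dsum_addA : associative dsum_add.
Proof. by move=> u v w; apply: dsumP => i; exact: addrA. Qed.
Lemma dsum_addC : commutative dsum_add.
Proof. by move=> u v; apply: dsumP => i; exact: addrC. Qed.
Lemma dsum_add0 : left_id dsum0 dsum_add.
Proof. by move=> u; apply: dsumP => i; exact: add0r. Qed.
Lemma dsum_addN : left_inverse dsum0 dsum_opp dsum_add.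
Proof. by move=> u; apply: dsumP => i; exact: addNr. Qed.

HB.instance Definition _ := GRing.isZmodule.Build dsum
  dsum_addA dsum_addC dsum_add0 dsum_addN.

Lemma dsum_scaleA a b u : dsum_scale a (dsum_scale b u) = dsum_scale (a * b) u.
Proof. by apply: dsumP => i; exact: scalerA. Qed.
Lemma dsum_scale1 : left_id 1 dsum_scale.
Proof. by move=> u; apply: dsumP => i; exact: scale1r. Qed.
Lemma dsum_scaleDr : right_distributive dsum_scale +%R.
Proof. by move=> a u v; apply: dsumP => i; exact: scalerDr. Qed.
Lemma dsum_scaleDl u : {morph dsum_scale^~ u : a b / a + b}.
Proof. by move=> a b; apply: dsumP => i; exact: scalerDl. Qed.

HB.instance Definition _ := GRing.Zmodule_isLmodule.Build k dsum
  dsum_scaleA dsum_scale1 dsum_scaleDr dsum_scaleDl.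

Lemma dsum_evalP a (u v : dsum) i : (a *: u + v) i = a *: u i + v i.
Proof. by []. Qed.

Definition dinj_fun i (x : V i) j : V j :=
  if i =P j is ReflectT e then ecast j (V j) e x else 0.

Lemma dinj_supp i (x : V i) : fin_supp (dinj_fun x).
Proof.
apply/asboolP; exists i.+1 => j ij; rewrite /dinj_fun.
by case: eqP => // e; exfalso; move: ij; rewrite e ltnn.
Qed.

Definition dinj i (x : V i) : dsum := DSum (dinj_supp x).

Lemma dinj_id i (x : V i) : dinj x i = x.
Proof.
by rewrite /= /dinj_fun; case: eqP => // e; rewrite (eq_axiomK e).
Qed.

Lemma dinj_neq i j (x : V i) : i != j -> dinj x j = 0.
Proof. by rewrite /= /dinj_fun; case: eqP. Qed.

Lemma dinj_linear i : linear (@dinj i).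
Proof.
move=> a x y; apply: dsumP => j; rewrite dsum_evalP.
have [<-|ij] := eqVneq i j; first by rewrite !dinj_id.
by rewrite !dinj_neq // scaler0 addr0.
Qed.

Definition dbound (u : dsum) : nat := projT1 (cid (dsum_supp u)).

Definition dlift (W : lmodType k) (g : forall i, V i -> W) (u : dsum) : W :=
  \sum_(i < dbound u) @g i (u i).

Section Lift.
Variables (W : lmodType k) (g : forall i, V i -> W).
Hypothesis g_lin : forall i, linear (@g i).

Lemma dliftE (u : dsum) N : (forall i, (N <= i)%N -> u i = 0) ->
  dlift g u = \sum_(i < N) @g i (u i).
Proof.
have g0 i : @g i 0 = 0 by have [_ _] := linearPP (@g_lin i).
have widen M M' : (forall i, (M <= i)%N -> u i = 0) -> (M <= M')%N ->
    \sum_(i < M) @g i (u i) = \sum_(i < M') @g i (u i).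
  move=> uM le; rewrite (big_ord_widen M' (fun i => @g i (u i)) le).
  rewrite [RHS](bigID (fun i : 'I_M' => (i < M)%N)) /=.
  rewrite [X in _ + X]big1 ?addr0 // => i; rewrite -leqNgt => /uM ->.
  exact: g0.
move=> uN; have uB := projT2 (cid (dsum_supp u)).
rewrite /dlift (widen _ (maxn (dbound u) N) uB (leq_maxl _ _)).
by rewrite (widen _ (maxn (dbound u) N) uN (leq_maxr _ _)).
Qed.

Lemma dlift_linear : linear (dlift g).
Proof.
move=> a u v; have [[N uN] [M vM]] := (dsum_supp u, dsum_supp v).
have uN' i : (maxn N M <= i)%N -> u i = 0 by rewrite geq_max => /andP[/uN].
have vM' i : (maxn N M <= i)%N -> v i = 0 by rewrite geq_max => /andP[_ /vM].
rewrite (dliftE uN') (dliftE vM') (@dliftE _ (maxn N M)).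
  rewrite scaler_sumr -big_split; apply: eq_bigr => i _; exact: g_lin.
by move=> i le; rewrite /= uN' // vM' // scaler0 addr0.
Qed.

Lemma dlift_inj i (x : V i) : dlift g (dinj x) = @g i x.
Proof.
have g0 j : @g j 0 = 0 by have [_ _] := linearPP (@g_lin j).
rewrite (@dliftE _ i.+1) => [|j ij].
  rewrite big_ord_recr big1 /= ?add0r => [|j _].
    by have /= -> := dinj_id x.
  by have /= -> := dinj_neq x (_ : i != j); rewrite ?g0 // gtn_eqF.
by rewrite dinj_neq // ltn_eqF.
Qed.

End Lift.

Lemma dsum_ind (P : dsum -> Prop) :
  P 0 -> (forall u v, P u -> P v -> P (u + v)) ->
  (forall i (x : V i), P (dinj x)) -> forall u, P u.
Proof.
move=> P0 PD Pi u; have [N uN] := dsum_supp u.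
suff -> : u = \sum_(i < N) dinj (u i) by elim/big_ind: _.
apply: dsumP => j.
have evD (v w : dsum) : (v + w) j = v j + w j by [].
rewrite (big_morph (fun v : dsum => v j) evD (erefl : (0 : dsum) j = 0)).
have [jN|jN] := ltnP j N.
  rewrite (bigD1 (Ordinal jN)) //= big1 ?addr0 => [|i ij].
    by have /= -> := dinj_id (u j).
  by have /= -> := dinj_neq (u i) (_ : val i != j).
rewrite big1 ?uN // => i _; rewrite dinj_neq // ltn_eqF //.
exact: leq_trans jN.
Qed.

End DirectSum.

Arguments dinj {k V} i x.

(* Indices are shifted by one: the component of index i is the tensor power of
   exponent i.+1, so that there is no component in degree 0. *)
Definition tensalg (k : comNzRingType) (D : lmodType k) : Type :=
  dsum (fun i => tpow D i.+1).

Section TensorAlgebra.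
Variables (k : comNzRingType) (D : lmodType k).
Local Notation T := (tensalg D).
Local Notation tp := (fun i => tpow D i.+1).

HB.instance Definition _ := GRing.Lmodule.on T.

(* [tconcat x y] has type [tpow D (i.+1 + j.+1)], which is convertible to
   [tp (i + j.+1)] *)
Definition tcomp_mul i j (x : tpow D i.+1) (y : tpow D j.+1) : T :=
  @dinj k tp (i + j.+1)%N (tconcat x y).

Definition tmul (u v : T) : T :=
  dlift (fun i x => dlift (fun j y => tcomp_mul x y) v) u.

Definition tword n (t : n.+1.-tuple D) : T := @dinj k tp n (tpure t).

Lemma tcomp_mulPl i j a (x y : tpow D i.+1) (z : tpow D j.+1) :
  tcomp_mul (a *: x + y) z = a *: tcomp_mul x z + tcomp_mul y z.
Proof. by rewrite /tcomp_mul tconcatPl; exact: (@dinj_linear k tp). Qed.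

Lemma tcomp_mulPr i j a (x : tpow D i.+1) (y z : tpow D j.+1) :
  tcomp_mul x (a *: y + z) = a *: tcomp_mul x y + tcomp_mul x z.
Proof. by rewrite /tcomp_mul tconcatPr; exact: (@dinj_linear k tp). Qed.

Let inner_lin i (x : tpow D i.+1) j :
  linear (fun y : tpow D j.+1 => tcomp_mul x y).
Proof. by move=> a y z; exact: tcomp_mulPr. Qed.

Let outer_lin (v : T) i :
  linear (fun x : tpow D i.+1 => dlift (fun j y => tcomp_mul x y) v).
Proof.
move=> a x y; rewrite /dlift scaler_sumr -big_split; apply: eq_bigr => j _.
exact: tcomp_mulPl.
Qed.

Lemma tmulPl a u v w : tmul (a *: u + v) w = a *: tmul u w + tmul v w.
Proof. exact: (dlift_linear (outer_lin w)). Qed.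

Lemma tmulPr a u v w : tmul u (a *: v + w) = a *: tmul u v + tmul u w.
Proof.
rewrite /tmul /dlift scaler_sumr -big_split; apply: eq_bigr => i _.
exact: (dlift_linear (@inner_lin _ _)).
Qed.

Lemma tmul_word m n (s : m.+1.-tuple D) (t : n.+1.-tuple D) :
  tmul (tword s) (tword t) =
  @tword (m + n.+1) [tuple of s ++ t].
Proof.
rewrite /tmul /tword (dlift_inj (outer_lin _)) (dlift_inj (@inner_lin _ _)).
by rewrite /tcomp_mul tconcat_pure.
Qed.

Lemma tword_congr m n (s : m.+1.-tuple D) (t : n.+1.-tuple D) :
  tval s = tval t -> tword s = tword t.
Proof.
move=> st; have mn : m = n.
  by apply/succn_inj; rewrite -(size_tuple s) -(size_tuple t) st.
by move: s st; rewrite mn => s st; congr tword; exact: val_inj.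
Qed.

Lemma tensalg_ind (P : T -> Prop) :
  P 0 -> (forall a u v, P u -> P v -> P (a *: u + v)) ->
  (forall n (t : n.+1.-tuple D), P (tword t)) -> forall u, P u.
Proof.
move=> P0 PP Pt; apply: dsum_ind => // [u v Pu Pv|i x].
  by have := PP 1 u v Pu Pv; rewrite scale1r.
elim/tpow_ind: x => [|a x y Px Py|t]; last exact: Pt.
  by have [_ _ ->] := linearPP (@dinj_linear k tp i).
by rewrite (@dinj_linear k tp i); exact: PP.
Qed.

Lemma tmulA : associative tmul.
Proof.
have m0l w : tmul 0 w = 0.
  by have := tmulPl (-1) 0 0 w; rewrite scaler0 addr0 scaleN1r addNr.
have m0r w : tmul w 0 = 0.
  by have := tmulPr (-1) w 0 0; rewrite scaler0 addr0 scaleN1r addNr.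
move=> u v w; elim/tensalg_ind: u => [|a u u' IH IH'|m s].
- by rewrite !m0l.
- by rewrite !tmulPl IH IH'.
elim/tensalg_ind: v => [|a v v' IH IH'|n t].
- by rewrite m0l !m0r m0l.
- by rewrite tmulPl !tmulPr tmulPl IH IH'.
elim/tensalg_ind: w => [|a w w' IH IH'|p r].
- by rewrite !m0r.
- by rewrite !tmulPr IH IH'.
by rewrite !tmul_word; apply: tword_congr; rewrite /= catA.
Qed.

HB.instance Definition _ := Lmodule_isNuAlgebra.Build k T tmulA tmulPl tmulPr.

Definition tinj (x : D) : T := tword [tuple x].

(* The element x (x) y of the tensor square of D. *)
Definition tpair (x y : D) : T := tword [tuple x; y].

End TensorAlgebra.

Arguments tinj {k} D x.

Definition is_free_rb (k : comNzRingType) (lam : k) (B : nuAlgType k)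
    (S : rbAlgType lam) (j : B -> S) :=
  nualg_hom j /\
  forall (A : rbAlgType lam) (f : B -> A), nualg_hom f ->
    exists g : S -> A, [/\ rb_hom g, g \o j =1 f &
      forall g' : S -> A, rb_hom g' -> g' \o j =1 f -> g' =1 g].

Definition is_enveloping_rb (k : comNzRingType) (lam : k) (D : dendType k)
    (U : rbAlgType lam) (rho : D -> U) :=
  dend_hom (rho : D -> rbDend U) /\
  forall (A : rbAlgType lam) (f : D -> A), dend_hom (f : D -> rbDend A) ->
    exists g : U -> A, [/\ rb_hom g, g \o rho =1 f &
      forall g' : U -> A, rb_hom g' -> g' \o rho =1 f -> g' =1 g].

(* Elements of D and T(D) are mapped into S by the structure map [j]; thus
   [rbop (j (tinj D y))] is the bracket of y. *)
Definition env_rel (k : comNzRingType) (lam : k) (D : dendType k)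
    (S : rbAlgType lam) (j : tensalg D -> S) : set S :=
  [set r | exists x y : D,
      r = j (tinj D (x -< y)) - j (tinj D x) ** rbop (j (tinj D y))
          - lam *: j (tpair x y)
   \/ r = j (tinj D (x >- y)) - rbop (j (tinj D x)) ** j (tinj D y)].

(* Main.v *)
Require Import Defs.
From mathcomp Require Import all_boot all_order all_algebra.
From mathcomp Require Import classical_sets.

(** The quotient represents, by chaining universal properties, the functor of
    dendriform morphisms out of [D].  For a Rota-Baxter algebra [A], a linear
    map [f : D -> A] is the same as an algebra morphism [tensalg D -> A]
    ([tensalg_ext_hom], [tensalg_hom_eq]), hence, by freeness of [Sha], the same
    as a Rota-Baxter morphism [h : Sha -> A].  Evaluated on the two families of
    generators of [J], such an [h] gives
      f (x -< y) - (f x ** rbop (f y) + lam *: (f x ** f y))   and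
      f (x >- y) - rbop (f x) ** f y,
    because [j (tpair x y)] is a product in [Sha] ([tpair_mul]).  So [h] kills
    the generators exactly when [f] is a dendriform morphism to [rbDend A]; as
    the kernel of [h] is a Rota-Baxter ideal, this is also when [h] kills [J]
    ([rbgen_sub_ker]), that is, when it descends to the quotient
    ([rbquot_factor]).  The same computation applied to the quotient map itself
    shows that [rho] is a dendriform morphism ([env_rel_pi]). *)

Set Implicit Arguments.
Unset Strict Implicit.
Unset Printing Implicit Defensive.

Import GRing.Theory.

Local Open Scope ring_scope.

(** * Composition of linear maps and of morphisms *)

Lemma linear_comp (k : comNzRingType) (U V W : lmodType k) (f : U -> V)
    (g : V -> W) : linear f -> linear g -> linear (g \o f).
Proof. by move=> lf lg a x y /=; rewrite lf lg. Qed.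

Lemma nualg_hom_comp (k : comNzRingType) (A B C : nuAlgType k) (f : A -> B)
    (g : B -> C) : nualg_hom f -> nualg_hom g -> nualg_hom (g \o f).
Proof.
move=> [lf mf] [lg mg]; split; first exact: linear_comp.
by move=> x y /=; rewrite mf mg.
Qed.

Lemma rb_hom_comp (k : comNzRingType) (lam : k) (A B C : rbAlgType lam)
    (f : A -> B) (g : B -> C) : rb_hom f -> rb_hom g -> rb_hom (g \o f).
Proof.
move=> [hf rf] [hg rg]; split; first exact: nualg_hom_comp.
by move=> x /=; rewrite rf rg.
Qed.

Lemma linearB_fun (k : comNzRingType) (U V : lmodType k) (f : U -> V) :
  linear f -> forall x y, f (x - y) = f x - f y.
Proof.
by move=> lf x y; have [fD fZ _] := linearPP lf; rewrite fD -scaleN1r fZ scaleN1r.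
Qed.

Lemma tuple1_eta (T : Type) (t : 1.-tuple T) : t = [tuple thead t].
Proof. by case/tupleP: t => x t; apply: val_inj; rewrite /= [t]tuple0. Qed.

(** * The universal property of the tensor algebra *)

Section TensorAlgebraUniversal.
Variables (k : comNzRingType) (D : lmodType k).

Lemma tinj_linear : linear (tinj D).
Proof.
(* A word of length one is linear in its letter by multilinearity, once that
   letter is written as the updated entry of a fixed tuple. *)
move=> a x y; pose t : 1.-tuple D := [tuple 0].
have tinjE z : tinj D z = tword (tupd t ord0 z).
  by rewrite (tuple1_eta (tupd t ord0 z)) /thead tnth_mktuple eqxx.
rewrite !tinjE /tword (@tpure_multilinear k D 1).
exact: (@dinj_linear k (fun i => tpow D i.+1)).
Qed.

Lemma tpair_mul (x y : D) : tpair x y = tinj D x ** tinj D y.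
Proof. by rewrite [RHS]tmul_word; apply: tword_congr. Qed.

Lemma tword_cons n (x : D) (t : n.+1.-tuple D) :
  tword [tuple of x :: t] = tinj D x ** tword t.
Proof. by rewrite [RHS]tmul_word; apply: tword_congr. Qed.

(** The algebra is generated by [D], because a word is the product of its
    letters. *)
Lemma tensalg_hom_eq (A : nuAlgType k) (g h : tensalg D -> A) :
  nualg_hom g -> nualg_hom h -> g \o tinj D =1 h \o tinj D -> g =1 h.
Proof.
move=> [lg mg] [lh mh] gh; elim/tensalg_ind => [|a u v IHu IHv|n t].
- by have [[_ _ ->] [_ _ ->]] := (linearPP lg, linearPP lh).
- by rewrite lg lh IHu IHv.
elim: n t => [|n IHn] t.
  by rewrite (tuple1_eta t); exact: gh.
by rewrite (tuple_eta t) tword_cons mg mh IHn; congr (_ ** _); exact: gh.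
Qed.

Section Extension.
Variables (A : nuAlgType k) (f : D -> A).
Hypothesis f_lin : linear f.

(** As [A] has no unit, the value on the empty word is arbitrary; it never
    enters a product of letters. *)
Fixpoint wprod (s : seq D) : A :=
  match s with
  | [::] => 0
  | [:: x] => f x
  | x :: s' => f x ** wprod s'
  end.

Lemma wprod_cons x s : s != [::] -> wprod (x :: s) = f x ** wprod s.
Proof. by case: s. Qed.

Lemma wprod_cat s t : s != [::] -> t != [::] ->
  wprod (s ++ t) = wprod s ** wprod t.
Proof.
move=> + tn0; elim: s => // x [|y s] IHs _; first by rewrite cat1s wprod_cons.
by rewrite cat_cons wprod_cons // IHs // (wprod_cons x) // numulA.
Qed.

Lemma wprod_linear s1 s2 : linear (fun x => wprod (s1 ++ x :: s2)).
Proof.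
move=> a x y; elim: s1 => [|z s1 IHs] /=.
  by case: s2 => [|z s2]; rewrite f_lin // numulPl.
have n0 w : s1 ++ w :: s2 != [::] by case: s1 {IHs}.
by rewrite -!/(wprod (z :: _)) !wprod_cons // IHs numulPr.
Qed.

Lemma val_tupd n (t : n.-tuple D) i x :
  tupd t i x = take i t ++ x :: drop i.+1 t :> seq D.
Proof.
have szi : size (take i t) = i by rewrite size_takel // size_tuple ltnW.
apply: (@eq_from_nth _ x) => [|l].
  by rewrite size_tuple size_cat szi /= size_drop size_tuple addnS -addSn subnKC.
rewrite size_tuple => ln; rewrite -(tnth_nth x _ (Ordinal ln)) tnth_mktuple.
rewrite nth_cat szi -val_eqE /= (tnth_nth x) /=.
case: ltngtP => [li|il|->]; first by rewrite nth_take.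
  by rewrite -[in RHS](subnKC il) addSn -addnS addKn /= nth_drop subnKC.
by rewrite subnn.
Qed.

Lemma wprod_multilinear n : multilinear (fun t : n.-tuple D => wprod t).
Proof. by move=> t i a x y; rewrite !val_tupd wprod_linear. Qed.

Definition tensalg_ext (u : tensalg D) : A :=
  dlift (fun i => tlift (fun t : i.+1.-tuple D => wprod t)) u.

Let comp_linear i : linear (tlift (fun t : i.+1.-tuple D => wprod t)).
Proof. exact: (tlift_linear (@wprod_multilinear _)). Qed.

Lemma tensalg_ext_word n (t : n.+1.-tuple D) : tensalg_ext (tword t) = wprod t.
Proof.
rewrite /tensalg_ext /tword (dlift_inj comp_linear).
exact: (tlift_pure (@wprod_multilinear _)).
Qed.

Lemma tensalg_ext_tinj x : tensalg_ext (tinj D x) = f x.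
Proof. exact: tensalg_ext_word. Qed.

Lemma tensalg_ext_hom : nualg_hom tensalg_ext.
Proof.
have ext_lin : linear tensalg_ext := dlift_linear comp_linear.
have [_ _ ext0] := linearPP ext_lin.
have tuple_n0 n (t : n.+1.-tuple D) : tval t != [::].
  by rewrite -size_eq0 size_tuple.
split=> // u v; elim/tensalg_ind: u => [|a u u' IH IH'|m s].
- by rewrite numul0l ext0 numul0l.
- by rewrite numulPl !ext_lin numulPl IH IH'.
elim/tensalg_ind: v => [|a v v' IH IH'|n t].
- by rewrite numul0r ext0 numul0r.
- by rewrite numulPr !ext_lin numulPr IH IH'.
by rewrite [tword s ** tword t]tmul_word !tensalg_ext_word wprod_cat.
Qed.

End Extension.

End TensorAlgebraUniversal.

(** * Quotients by Rota-Baxter ideals *)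

Section QuotientUniversal.
Variables (k : comNzRingType) (lam : k) (A B : rbAlgType lam) (h : A -> B).
Hypothesis h_hom : rb_hom h.

(** The kernel of a Rota-Baxter morphism is one of the ideals intersected in
    [rbgen X], so it is enough to test the generators. *)
Lemma rbgen_sub_ker (X : set A) :
  (forall x, X x -> h x = 0) -> forall x, submod_set (rbgen X) x -> h x = 0.
Proof.
move=> X0; have [[lh mh] rh] := h_hom; have [_ _ h0] := linearPP lh.
have [_ _ rb0] := linearPP (@rbop_linear k lam B).
have kerP (a : k) u v : h u = 0 -> h v = 0 -> h (a *: u + v) = 0.
  by move=> hu hv; rewrite lh hu hv scaler0 addr0.
pose K := @Submodule k A [set x | h x = 0]%classic h0 kerP.
have KMl a x : submod_set K x -> submod_set K (a ** x).
  by move=> /= hx; rewrite mh hx numul0r.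
have KMr x a : submod_set K x -> submod_set K (x ** a).
  by move=> /= hx; rewrite mh hx numul0l.
have KR x : submod_set K x -> submod_set K (rbop x).
  by move=> /= hx; rewrite rh hx.
by move=> x /(_ (RBIdeal KMl KMr KR)); apply.
Qed.

Lemma rbquot_factor (I : rbideal A) : (forall x, submod_set I x -> h x = 0) ->
  exists2 g : rbquot I -> B, rb_hom g & g \o rbpi I =1 h.
Proof.
move=> hI; have [[lh mh] rh] := h_hom; have [[lp mp] rp] := rbpi_hom I.
pose g (q : rbquot I) : B := h (repr q).
have gE x : g (rbpi I x) = h x.
  apply/eqP; rewrite -subr_eq0 -(linearB_fun lh); apply/eqP/hI/rbpi_eq.
  exact: rbpi_repr.
exists g => //; split; first split.
- move=> a p q; rewrite -[p]rbpi_repr -[q]rbpi_repr.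
  by rewrite -lp !gE lh.
- by move=> p q; rewrite -[p]rbpi_repr -[q]rbpi_repr -mp !gE mh.
- by move=> p; rewrite -[p]rbpi_repr -rp !gE rh.
Qed.

End QuotientUniversal.

(** * The enveloping algebra *)

Section Enveloping.
Variables (k : comNzRingType) (lam : k) (D : dendType k) (Sha : rbAlgType lam).
Variable j : tensalg D -> Sha.
Hypothesis j_hom : nualg_hom j.

(** Since [j] and [h] are multiplicative and [h] commutes with the operators, [h]
    sends each defining relation to the defect of the restriction of [h] to [D]
    in preserving [-<] or [>-].  One direction serves for the quotient map, the
    other for the extension of a given dendriform morphism. *)
Lemma env_rel_ker (A : rbAlgType lam) (h : Sha -> A) : rb_hom h ->
  (forall r, env_rel j r -> h r = 0) <->
  dend_hom ((fun x => h (j (tinj D x))) : D -> rbDend A).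
Proof.
move=> [[lh mh] rh]; have hB := linearB_fun lh; have [lj mj] := j_hom.
have [_ hZ _] := linearPP lh.
split=> [h0|[_ hprec hsucc] r [x [y [->|->]]]].
- split=> [|x y|x y].
  + exact: linear_comp (linear_comp (@tinj_linear k D) lj) lh.
  + apply/eqP; rewrite -subr_eq0 /dprec /= /rb_prec; apply/eqP.
    rewrite opprD addrA -rh -!mh -hZ -mj -tpair_mul -!hB.
    by apply: h0; exists x, y; left.
  + apply/eqP; rewrite -subr_eq0 /dsucc /= /rb_succ; apply/eqP.
    rewrite -rh -mh -hB.
    by apply: h0; exists x, y; right.
- rewrite !hB hZ tpair_mul mj !mh rh hprec.
  by rewrite -addrA -opprD; apply: subrr.
- by rewrite hB mh rh hsucc; apply: subrr.
Qed.

End Enveloping.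

Theorem theorem3p5 (k : fieldType) (lam : k) (D : dendType k)
    (Sha : rbAlgType lam) (j : tensalg D -> Sha) (j_free : is_free_rb j) :
  let J := rbgen (env_rel j) in
  let rho : D -> rbquot J := fun x => rbpi J (j (tinj D x)) in
  is_enveloping_rb rho.
Proof.
move=> J rho; have [j_hom j_univ] := j_free; have pi_hom := rbpi_hom J.
split=> [|A f f_dend].
  apply/(env_rel_ker j_hom pi_hom) => r r_rel.
  have [_ _ <-] := linearPP (@rbpi_linear k lam Sha J).
  by apply/rbpi_eq; rewrite subr0 => I subI; exact: subI r_rel.
have [f_lin f_prec f_succ] := f_dend.
have F_hom := tensalg_ext_hom f_lin.
have [h [h_hom hj h_uniq]] := j_univ A _ F_hom.
have hf x : h (j (tinj D x)) = f x by rewrite [LHS]hj tensalg_ext_tinj.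
have hJ : forall x, submod_set J x -> h x = 0.
  apply: (rbgen_sub_ker h_hom); apply/(env_rel_ker j_hom h_hom).
  by split=> [a x y|x y|x y]; rewrite !hf ?f_lin ?f_prec ?f_succ.
have [g g_hom gh] := rbquot_factor h_hom hJ.
exists g; split=> // [x|g' g'_hom g'f q]; first by rewrite [LHS]gh hf.
have g'pi_hom := rb_hom_comp pi_hom g'_hom.
rewrite -[q]rbpi_repr [RHS]gh; apply: (h_uniq (g' \o rbpi J)) => //.
apply: tensalg_hom_eq => // [|x]; last by rewrite [LHS]g'f /= tensalg_ext_tinj.
by apply: nualg_hom_comp j_hom _; case: g'pi_hom.
Qed.
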